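(* Let $E$ be a complex Banach space, let $A, B \in B(E)$ satisfy $AB = BA$, and let $V_{A,B} : B(E) \to B(E)$ be the elementary operator defined by $V_{A,B}(X) = AXB - BXA$ for all $X \in B(E)$. If there exist $\lambda, \mu \in \mathbb{C}$ such that $A - \lambda I$ and $B - \mu I$ are nilpotent, then $V_{A,B}$ is nilpotent.
   Context: For a Banach space $E$, $B(E)$ denotes the algebra of all bounded linear operators on $E$, and $I$ denotes the identity operator on $E$. An operator $T$ (on $E$, or on $B(E)$) is nilpotent if $T^k = 0$ for some positive integer $k$; for an operator on $B(E)$, powers are taken with respect to composition. *)

(* Defs.v *)
From HB Require Import structures.
From mathcomp Require Import all_boot all_order all_algebra.
From mathcomp Require Import all_classical all_reals all_analysis.
From mathcomp.real_closed Require Export complex.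

Set Implicit Arguments.
Unset Strict Implicit.
Unset Printing Implicit Defensive.

Import Order.TTheory GRing.Theory Num.Theory.
Import numFieldNormedType.Exports.

Local Open Scope classical_set_scope.
Local Open Scope ring_scope.

Section BoundedOperators.
Variables (K : numFieldType) (E : normedModType K).

(* As the norm takes its values in K, so does M; when K = R[i] and E != 0 the
   inequality forces M to be real and nonnegative. *)
Definition bounded_linear (T : E -> E) : Prop :=
  linear T /\ exists M : K, forall x : E, `|T x| <= M * `|x|.

Definition bounded_linear_pred : {pred (E -> E)} :=
  fun T => `[< bounded_linear T >].

Record bounded_op := BoundedOp {
  bounded_op_fun :> E -> E ;
  _ : bounded_op_fun \in bounded_linear_pred }.

HB.instance Definition _ := [isSub for bounded_op_fun].
HB.instance Definition _ := [Choice of bounded_op by <:].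

Lemma bounded_opP (T : bounded_op) : bounded_linear T.
Proof. by case: T => T /= /asboolP. Qed.

Lemma bounded_linearP (T : {linear E -> E}) :
  bounded_linear T <-> continuous T.
Proof.
rewrite -linear_bounded_continuous; split=> [[_ [M TM]]|/linear_boundedP].
  apply/bounded_funP => r; exists (`|M| * r) => x xr.
  apply: le_trans (TM x) _.
  have [->|x0] := eqVneq x 0.
    rewrite normr0 mulr0 mulr_ge0//.
    by apply: le_trans xr.
  have M0 : 0 <= M.
    rewrite -(pmulr_lge0 M (_ : 0 < `|x|)) ?normr_gt0//.
    exact: le_trans (TM x).
  by rewrite ger0_norm// ler_wpM2l.
move=> [y [yreal Ty]]; split; first exact: linearP.
by exists (y + 1); apply: Ty; rewrite ltrDl.
Qed.

Lemma bounded_linear_submod_closed : submod_closed bounded_linear_pred.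
Proof.
split.
  apply/asboolP; split=> [a x y|].
    by rewrite /GRing.zero/= scaler0 addr0.
  by exists 0 => x; rewrite mul0r [X in `|X|](_ : _ = 0)// normr0.
move=> a S T /asboolP[Sl [M SM]] /asboolP[Tl [N TN]]; apply/asboolP; split.
  move=> c x y; rewrite -![(a *: S + T) _]/(a *: S _ + T _).
  rewrite Sl Tl scalerDr scalerDr !scalerA [a * c]mulrC.
  by rewrite addrACA.
exists (`|a| * M + N) => x; rewrite -![(a *: S + T) _]/(a *: S _ + T _).
rewrite (le_trans (ler_normD _ _))// mulrDl lerD// normrZ -mulrA.
exact: ler_wpM2l.
Qed.

HB.instance Definition _ := GRing.isSubmodClosed.Build K (E -> E)
  bounded_linear_pred bounded_linear_submod_closed.
HB.instance Definition _ := [SubChoice_isSubLmodule of bounded_op by <:].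

Lemma bounded_op_id_subproof : (id : E -> E) \in bounded_linear_pred.
Proof. by apply/asboolP; split=> //; exists 1 => x; rewrite mul1r. Qed.

Definition bounded_op_id : bounded_op := BoundedOp bounded_op_id_subproof.

Lemma bounded_op_comp_subproof (S T : bounded_op) :
  (S \o T : E -> E) \in bounded_linear_pred.
Proof.
have [Sl [M SM]] := bounded_opP S; have [Tl [N TN]] := bounded_opP T.
apply/asboolP; split=> [a x y|]; first by rewrite /= Tl Sl.
exists (`|M| * N) => x /=.
have [Tx0|Tx0] := eqVneq (T x) 0.
  rewrite Tx0 -[X in S X](subrr 0) -scaleN1r addrC Sl scaleN1r addNr normr0.
  by rewrite -mulrA mulr_ge0// (le_trans _ (TN x)).
have M0 : 0 <= M.
  rewrite -(pmulr_lge0 M (_ : 0 < `|T x|)) ?normr_gt0//.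
  exact: le_trans (SM _).
by rewrite (le_trans (SM _))// ger0_norm// -mulrA ler_wpM2l.
Qed.

Definition bounded_op_comp (S T : bounded_op) : bounded_op :=
  BoundedOp (bounded_op_comp_subproof S T).

Lemma bounded_op_eq (S T : bounded_op) : (forall x, S x = T x) -> S = T.
Proof. by move=> ST; apply/val_inj/funext. Qed.

Lemma bounded_op_compA : associative bounded_op_comp.
Proof. by move=> S T U; exact: bounded_op_eq. Qed.

Lemma bounded_op_comp1l : left_id bounded_op_id bounded_op_comp.
Proof. by move=> T; exact: bounded_op_eq. Qed.

Lemma bounded_op_comp1r : right_id bounded_op_id bounded_op_comp.
Proof. by move=> T; exact: bounded_op_eq. Qed.

Lemma bounded_op_compDl : left_distributive bounded_op_comp +%R.
Proof. by move=> S T U; exact: bounded_op_eq. Qed.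

Lemma bounded_op_compDr : right_distributive bounded_op_comp +%R.
Proof.
move=> S T U; apply: bounded_op_eq => x /=.
have [Sl _] := bounded_opP S.
have := Sl 1 (T x) (U x); rewrite !scale1r; exact.
Qed.

(* Only a ring with possibly 1 = 0, since E may be the zero space. *)
HB.instance Definition _ := GRing.Zmodule_isPzRing.Build bounded_op
  bounded_op_compA bounded_op_comp1l bounded_op_comp1r
  bounded_op_compDl bounded_op_compDr.

Lemma bounded_op1E (x : E) : (1 : bounded_op) x = x.
Proof. by []. Qed.

Lemma bounded_opME (S T : bounded_op) (x : E) : (S * T) x = S (T x).
Proof. by []. Qed.

Lemma bounded_opDE (S T : bounded_op) (x : E) : (S + T) x = S x + T x.
Proof. by []. Qed.

Lemma bounded_opBE (S T : bounded_op) (x : E) : (S - T) x = S x - T x.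
Proof. by []. Qed.

Lemma bounded_opZE (a : K) (T : bounded_op) (x : E) : (a *: T) x = a *: T x.
Proof. by []. Qed.

Definition elementary_op (A B X : bounded_op) : bounded_op :=
  A * X * B - B * X * A.

End BoundedOperators.

Notation "''B' ( E )" := (bounded_op E)
  (at level 8, format "''B' ( E )") : type_scope.

(* Used both with U = E and with U = 'B(E). *)
Definition nilpotent_op (U : zmodType) (T : U -> U) : Prop :=
  exists2 k : nat, (0 < k)%N & forall x : U, iter k T x = 0.

(* Main.v *)
Require Import Defs.
From mathcomp Require Import all_boot all_order all_algebra.
From mathcomp Require Import all_classical all_reals all_analysis.

Import GRing.Theory.
Local Open Scope ring_scope.

(** Since A and B commute, A X B - B X A = B [A, X] - A [B, X].  The derivation
[A, .] = [A - lambda, .] is the difference of left and right multiplication by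
the nilpotent A - lambda, so it is nilpotent, and similarly for [B, .].  All the
operators involved commute, and sums of commuting nilpotents and products of a
nilpotent with a commuting operator are nilpotent. *)

Lemma iter_morph_add (U : zmodType) (f : U -> U) (n : nat) :
  {morph f : x y / x + y} -> {morph iter n f : x y / x + y}.
Proof. by move=> fD x y; elim: n => //= n ->; rewrite fD. Qed.

Lemma morph_add0 (U : zmodType) (f : U -> U) :
  {morph f : x y / x + y} -> f 0 = 0.
Proof. by move=> fD; apply: (addrI (f 0)); rewrite -fD !addr0. Qed.

Lemma iter_commute (T : Type) (f g : T -> T) (n : nat) :
  (forall x, f (g x) = g (f x)) -> forall x, iter n f (g x) = g (iter n f x).
Proof. by move=> fg x; elim: n => //= n ->. Qed.

Lemma nilpotent_op_add (U : zmodType) (f g : U -> U) :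
  {morph f : x y / x + y} -> {morph g : x y / x + y} ->
  (forall x, f (g x) = g (f x)) -> nilpotent_op f -> nilpotent_op g ->
  nilpotent_op (fun x => f x + g x).
Proof.
move=> fD gD fg [m m0 fm] [n n0 gn]; set h := fun x => f x + g x.
have hD : {morph h : x y / x + y} by move=> x y; rewrite /h fD gD addrACA.
(* Expanding the power of [h] one factor at a time replaces the binomial theorem. The invariant is
   the total degree [i + j + s]; once [s = 0], either [m <= i] or [n <= j]. *)
suff hs s i j x : (m + n <= i + j + s)%N ->
    iter s h (iter i f (iter j g x)) = 0.
  exists (m + n)%N; first by rewrite addn_gt0 m0.
  by move=> x; rewrite -[RHS](hs (m + n)%N 0%N 0%N x).
elim: s i j => [|s IHs] i j le_mn.
  rewrite addn0 in le_mn; have [le_mi|lt_im] := leqP m i.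
    by rewrite /= -(subnKC le_mi) iterD fm.
  have le_nj : (n <= j)%N.
    by rewrite -(leq_add2l m) (leq_trans le_mn)// leq_add2r ltnW.
  rewrite /= -(subnKC le_nj) iterD gn.
  exact/morph_add0/iter_morph_add.
(* The innermost [h] is split and the remaining [s] copies distribute over the sum. Moving [g] past
   the powers of [f] leaves two terms, with [i] or [j] raised by one, so the total degree is
   unchanged. *)
rewrite iterSr {2}/h iter_morph_add// -(iter_commute _ _ _ _ fg) -!iterS.
by rewrite !IHs ?addr0// ?addnS ?addSn -?addnS.
Qed.

(** By commutation the k-th iterate is [f^k] after [g^k]. With [f^k] outermost it vanishes whatever
    the value of [g^k x]. *)
Lemma nilpotent_op_comp (U : zmodType) (f g : U -> U) :
  (forall x, f (g x) = g (f x)) -> nilpotent_op f ->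
  nilpotent_op (fun x => g (f x)).
Proof.
move=> fg [k k0 fk]; exists k => // x.
suff -> n : iter n (fun x => g (f x)) x = iter n f (iter n g x) by exact: fk.
by elim: n => //= n ->; rewrite -fg (iter_commute _ _ _ _ fg).
Qed.

Lemma nilpotent_op_mull (S : pzRingType) (a : S) (k : nat) :
  (0 < k)%N -> a ^+ k = 0 -> nilpotent_op (fun x => a * x).
Proof.
move=> k0 ak; exists k => // x.
by rewrite -[RHS](mul0r x) -ak; elim: (k) => [|n /= ->]; rewrite ?mul1r// exprS mulrA.
Qed.

Lemma nilpotent_op_mulr (S : pzRingType) (a : S) (k : nat) :
  (0 < k)%N -> a ^+ k = 0 -> nilpotent_op (fun x => x * a).
Proof.
move=> k0 ak; exists k => // x.
by rewrite -[RHS](mulr0 x) -ak; elim: (k) => [|n /= ->]; rewrite ?mulr1// exprSr mulrA.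
Qed.

(** Subtracting the central [c] from [a] does not change the commutator. Left and right
    multiplications commute by associativity, so the sum of commuting nilpotents applies. *)
Lemma nilpotent_op_commutator (S : pzRingType) (a c : S) (k : nat) :
  (forall x, GRing.comm c x) -> (0 < k)%N -> (a - c) ^+ k = 0 ->
  nilpotent_op (fun x => a * x - x * a).
Proof.
move=> cC k0 ack.
have -> : (fun x => a * x - x * a) =
    (fun x => (a - c) * x + x * - (a - c)).
  apply/funext => x.
  by rewrite mulrN mulrBl mulrBr opprB cC addrA subrK.
apply: nilpotent_op_add => [x y|x y|x||].
- exact: mulrDr.
- exact: mulrDl.
- exact: mulrA.
- exact: nilpotent_op_mull ack.
- by apply: (nilpotent_op_mulr _ _ k) => //; rewrite exprNn ack mulr0.
Qed.

Lemma commutator_add (S : pzRingType) (a : S) :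
  {morph (fun x => a * x - x * a) : x y / x + y}.
Proof. by move=> x y; rewrite mulrDr mulrDl opprD addrACA. Qed.

Lemma commutator_mull (S : pzRingType) (a b x : S) :
  GRing.comm a b -> a * (b * x) - (b * x) * a = b * (a * x - x * a).
Proof. by move=> ab; rewrite mulrBr !mulrA ab. Qed.

(** This is the Jacobi identity when [[a, b] = 0]. *)
Lemma commutator_commute (S : pzRingType) (a b x : S) : GRing.comm a b ->
  a * (b * x - x * b) - (b * x - x * b) * a =
  b * (a * x - x * a) - (a * x - x * a) * b.
Proof.
move=> ab; have xab : x * b * a = x * a * b by rewrite -!mulrA ab.
rewrite !(mulrBr, mulrBl) !mulrA ab xab !opprB.
by rewrite addrACA [RHS]addrACA [- _ - _]addrC.
Qed.

(** Passes from nilpotency on vectors of [E] to a vanishing power in the ring ['B(E)]. *)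
Lemma bounded_op_expE (K : numFieldType) (E : normedModType K) (T : 'B(E))
  (n : nat) (x : E) : (T ^+ n) x = iter n T x.
Proof. by elim: n => //= n <-; rewrite exprS. Qed.

Lemma scale_id_central (K : numFieldType) (E : normedModType K) (l : K)
  (T : 'B(E)) : GRing.comm (l *: (1 : 'B(E))) T.
Proof.
apply: bounded_op_eq => x; rewrite !bounded_opME !bounded_opZE !bounded_op1E.
have [Tl _] := bounded_opP T.
by rewrite (GRing.scalable_linear Tl).
Qed.

Lemma nilpotent_op_bounded_commutator (K : numFieldType) (E : normedModType K)
  (A : 'B(E)) (l : K) : nilpotent_op (A - l *: (1 : 'B(E))) ->
  nilpotent_op (fun X : 'B(E) => A * X - X * A).
Proof.
move=> [k k0 Ak]; apply: (nilpotent_op_commutator _ A (l *: (1 : 'B(E))) k) => [||].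
- exact: scale_id_central.
- exact: k0.
- by apply: bounded_op_eq => x; rewrite bounded_op_expE Ak.
Qed.

Theorem theorem2p3 (R : realType) (E : completeNormedModType R[i])
    (A B : 'B(E)) (hAB : A * B = B * A)
    (hnil : exists lambda mu : R[i],
      nilpotent_op (A - lambda *: (1 : 'B(E))) /\ nilpotent_op (B - mu *: (1 : 'B(E)))) :
  nilpotent_op (elementary_op A B).
Proof.
case: hnil => lambda [mu [/nilpotent_op_bounded_commutator nA]].
move=> /nilpotent_op_bounded_commutator nB.
(* The sign goes into [- A] to make this a sum; the terms [B A X] and [A B X] cancel by [hAB]. *)
have -> : elementary_op A B = fun X =>
    B * (A * X - X * A) + - A * (B * X - X * B).
  apply/funext => X; rewrite /elementary_op mulNr !mulrBr opprB !mulrA hAB.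
  by rewrite [RHS]addrC addrA subrK.
have cBA : GRing.comm B A by [].
have cBN : GRing.comm B (- A) by exact: commrN.
have cAN : GRing.comm A (- A) by exact: commrN.
apply: nilpotent_op_add => [X Y|X Y|X||].
- by rewrite commutator_add mulrDr.
- by rewrite commutator_add mulrDr.
(* Pulling [- A] out of [[A, .]] and [B] out of [[B, .]] reduces both composites to a product of [B]
   and [- A] times a double commutator. *)
- rewrite (commutator_mull _ A (- A))// (commutator_mull _ B B)//.
  by rewrite commutator_commute// !mulrA cBN.
- by apply: nilpotent_op_comp nA => X; exact: commutator_mull.
- by apply: nilpotent_op_comp nB => X; exact: commutator_mull.
Qed.
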